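(* Let $1<q<2<p<+\infty$ and $2<\theta\le 3$. Let $a_1\in L^{\frac{2}{2-q}}(\mathbb{R})\cap C(\mathbb{R})$ be a positive even function. Let $A:\mathbb{R}\to\mathbb{R}$ be Lipschitz, of class (at least) $C^1(\mathbb{R})$, non-decreasing, and such that there is $\gamma\in(0,1)$ with $0<\gamma\le A(t)$ for all $t\in\mathbb{R}$. Let $g:\mathbb{R}\to\mathbb{R}$ be continuous with $0\le s\,g(s)\le |s|^{\theta}$ for all $s\in\mathbb{R}$. If $\lambda>0$ is sufficiently large (i.e. there is $\Lambda_0>0$ such that for every $\lambda>\Lambda_0$), then the problem $$\begin{cases}-(A(u)u')'(t)+u(t)=\lambda a_1(t)|u(t)|^{q-1}+|u(t)|^{p-1}+g(|u'(t)|), & t\in\mathbb{R},\\ u(t)>0, & t\in\mathbb{R},\\ \lim_{t\to\pm\infty}u(t)=0\end{cases}$$ has no (positive) solution in $H^1(\mathbb{R})$.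
   Context: Here $(A(u)u')'(t)$ denotes the derivative of $t\mapsto A(u(t))u'(t)$. A solution in $H^1(\mathbb{R})$ means a function $u\in H^1(\mathbb{R})\cap C^2(\mathbb{R})$ satisfying the equation pointwise, together with positivity and the limit conditions. *)

(* Defs.v *)
From HB Require Import structures.
From mathcomp Require Import all_boot all_order all_algebra.
From mathcomp Require Import all_classical all_reals all_analysis.

Set Implicit Arguments.
Unset Strict Implicit.
Unset Printing Implicit Defensive.
Import Order.TTheory GRing.Theory Num.Theory.
Import numFieldNormedType.Exports.

Local Open Scope classical_set_scope.
Local Open Scope ring_scope.

(* In [ring_scope] these notations denote the formal derivatives of a
   polynomial. *)
Local Notation "f ^` ()" := (derive1 f) : ring_scope.
Local Notation "f ^` ( n )" := (derive1n n f) : ring_scope.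

(* [f^`(n)] is total, with an unspecified value where [f^`(n.-1)] is not
   derivable, so derivability has to be required at every lower order. *)
Definition class_C (R : realType) (k : nat) (f : R -> R) : Prop :=
  (forall j : nat, (j < k)%N -> forall x : R, derivable f^`(j) x 1) /\
  continuous f^`(k).

Definition test_function (R : realType) (phi : R -> R) : Prop :=
  (forall k : nat, class_C k phi) /\
  compact (closure [set x | phi x != 0]).

(* Used below only for [u] and [v] in L^2, in which case both integrands are
   integrable. *)
Definition weak_derivative (R : realType) (u v : R -> R) : Prop :=
  forall phi : R -> R, test_function phi ->
    \int[@lebesgue_measure R]_x (u x * phi^`() x) =
    - \int[@lebesgue_measure R]_x (v x * phi x).

(* Members are functions, not classes modulo a.e. equality, so that pointwise
   conditions can be put on them. *)
Definition sobolev_H1 (R : realType) (u : R -> R) : Prop :=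
  u \in Lfun (@lebesgue_measure R) 2%:E /\
  exists2 v : R -> R,
    v \in Lfun (@lebesgue_measure R) 2%:E & weak_derivative u v.

Definition H1_positive_solution (R : realType) (p q : R) (a1 A g : R -> R)
    (lambda : R) (u : R -> R) : Prop :=
  [/\ sobolev_H1 u, class_C 2 u,
      forall t : R,
        - (fun s : R => A (u s) * u^`() s)^`() t + u t =
        lambda * a1 t * `|u t| `^ (q - 1) + `|u t| `^ (p - 1)
          + g `|u^`() t|,
      forall t : R, 0 < u t &
      (u t @[t --> +oo%R] --> (0 : R)) /\ (u t @[t --> -oo%R] --> (0 : R))].

(* Main.v *)
Require Import Defs.
From HB Require Import structures.
From mathcomp Require Import all_boot all_order all_algebra.
From mathcomp Require Import all_classical all_reals all_analysis.
From mathcomp Require Import lra.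
Set Implicit Arguments.
Unset Strict Implicit.
Unset Printing Implicit Defensive.
Import Order.TTheory GRing.Theory Num.Theory.
Import numFieldNormedType.Exports.

Local Open Scope classical_set_scope.
Local Open Scope ring_scope.

(** Let [B] be the antiderivative of [A] with [B 0 = 0].  For a solution [u],
    the function [v = B u] has [v' = A(u) u'], so the equation becomes
      [v'' = u - lambda a1 u^(q-1) - u^(p-1) - g(|u'|)],
    in which the gradient term is nonnegative, as [g] has the sign of its
    argument.  The quasilinear operator is thus replaced by a plain second
    derivative, and only one-sided bounds on [v''] are used.

    The first step is a bound [u <= M] with [M] independent of [lambda].  It
    uses [v'' <= u - u^(p-1)]: the right side is at most 1 everywhere, and at
    most some [- d < 0] where [u >= 2], that is, where [v >= b := B 2].  If [v]
    were much larger than [b] at some point, then, moving in a direction in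
    which [v] does not increase, [v] would be concave down to height [b] and
    would arrive there with a steep slope; afterwards [v'' <= 1] is too weak to
    stop the descent before [v] becomes negative
    ([concave_above_height_le]).  A comparison of [u^(p-1)] with [A(u) u] would
    not give such a bound: [B] may grow quadratically while [p < 3].

    Once [u <= M], the coefficient [A(u)] is at most [A M], so that
    [v <= A(M) u], and the sublinear term dominates a linear one:
    [u^(q-1) >= u M^(q-2)], as [q < 2] ([sublinear_ge_linear]).  On [[-1, 1]]
    the weight [a1] has a positive minimum, so that for [lambda] large
    [v'' <= - 8 v] there.  A positive function cannot be so concave on an
    interval of length 2 ([no_strongly_concave]), which is the desired
    contradiction.  The two lemmas about [v] reduce, by the reflection
    [t -> - t], to a motion to the right starting with slope at most 0. *)

(** * Increments and reflections of differentiable functions *)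

Lemma mean_value (R : realType) (f df : R -> R) (a b : R) :
  a < b -> (forall x, a <= x <= b -> is_derive x 1 f (df x)) ->
  exists2 c, a < c < b & f b - f a = df c * (b - a).
Proof.
move=> ab fdf.
have [x||c cab ->] := @MVT R f df a b ab.
- rewrite in_itv /= => /andP[ax xb]; apply: fdf.
  by rewrite !ltW.
- apply: derivable_within_continuous => x; rewrite in_itv /= => xab.
  by have [] := fdf x xab.
by exists c => //; move: cab; rewrite in_itv.
Qed.

Lemma increment_le (R : realType) (f df : R -> R) (k a b : R) :
  a <= b -> (forall x, a <= x <= b -> is_derive x 1 f (df x)) ->
  (forall x, a < x < b -> df x <= k) -> f b <= f a + k * (b - a).
Proof.
rewrite le_eqVlt => /predU1P[->|ab] fdf dfk; first by rewrite subrr mulr0 addr0.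
have [c cab fab] := mean_value ab fdf.
by rewrite addrC -lerBlDr fab ler_wpM2r ?dfk// subr_ge0 ltW.
Qed.

Lemma increment_ge (R : realType) (f df : R -> R) (k a b : R) :
  a <= b -> (forall x, a <= x <= b -> is_derive x 1 f (df x)) ->
  (forall x, a < x < b -> k <= df x) -> f a + k * (b - a) <= f b.
Proof.
rewrite le_eqVlt => /predU1P[->|ab] fdf dfk; first by rewrite subrr mulr0 addr0.
have [c cab fab] := mean_value ab fdf.
by rewrite addrC -lerBrDr fab ler_wpM2r ?dfk// subr_ge0 ltW.
Qed.

Lemma is_derive_reflect (R : realType) (f df : R -> R) :
  (forall t : R, is_derive t 1 f (df t)) ->
  forall t : R, is_derive t 1 (fun s => f (- s)) (- df (- t)).
Proof.
move=> fdf t; rewrite -mulrN1.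
exact: (is_derive1_comp (fdf (- t)) (is_deriveNid (t : R^o) (1 : R^o))).
Qed.

(** The first time at which [f] is at most [b] is the minimum of the identity on
    a compact set. *)
Lemma first_passage_le (R : realType) (f : R -> R) (b t0 t1 : R) :
  continuous f -> t0 <= t1 -> f t1 <= b ->
  exists2 c, t0 <= c /\ f c <= b & forall t, t0 <= t -> t < c -> b < f t.
Proof.
move=> cf t01 ft1.
pose S := [set t | t0 <= t <= t1] `&` [set t | f t <= b].
have closed_t01 : closed [set t | t0 <= t <= t1].
  by rewrite -set_itvcc; exact: interval_closed.
have S0 : S !=set0 by exists t1; split => //=; rewrite t01 lexx.
have cS : compact S.
  apply: (@subclosed_compact _ _ `[t0, t1]); last by move=> t [/= + _]; rewrite in_itv.
  - apply: closedI; first exact: closed_t01.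
    by apply: (preimage_closed _ (@closed_le _ b)) => t _; exact: cf.
  - exact: segment_compact.
have [c /set_mem[/= /andP[t0c ct1] fcb] cmin] :=
  compact_EVT_min S0 cS (@continuous_subspaceT _ _ S id (fun=> cvg_id)).
exists c => // t t0t tc; rewrite ltNge; apply/negP => ftb.
have : c <= t by apply: cmin; apply/mem_set; split => //=; rewrite t0t (le_trans (ltW tc)).
by rewrite leNgt tc.
Qed.

(** * Concavity constraints on positive functions *)

(** From a height [V] above [b], with slope at most 0, the function reaches
    height [b] after some time [s] with slope [- W].  The acceleration gives
    [W >= d s]; concavity gives [W s >= V - b], the slope being steepest at the
    end.  Hence [W ^ 2 >= d (V - b)], whatever [s] is.  In the next [W / 2] units
    of time the slope stays below [- W / 2], a further loss of [W ^ 2 / 4],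
    which must be less than [b]. *)
Lemma no_high_descent (R : realType) (v v1 v2 : R -> R) (b d t0 : R) :
  (forall t : R, is_derive t 1 v (v1 t)) -> (forall t : R, is_derive t 1 v1 (v2 t)) ->
  (forall t, 0 < v t) -> 0 < b -> 0 < d ->
  (forall t, v2 t <= 1) -> (forall t, b <= v t -> v2 t <= - d) ->
  v1 t0 <= 0 -> v t0 <= b + 4 * b / d.
Proof.
move=> vv1 v1v2 vpos b0 d0 v2le1 v2led v1t0; rewrite leNgt; apply/negP => high.
have bV : b < v t0.
  by apply: lt_trans high; rewrite ltrDl divr_gt0// mulr_gt0.
have [t1 t01 vt1] : exists2 t1, t0 <= t1 & v t1 <= b.
  apply/not_exists2P => vb.
  have {}vb t : t0 <= t -> b <= v t.
    by move=> t0t; have [//|/negP] := vb t; rewrite -ltNge => /ltW.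
  have slope t : t0 + 1 <= t -> v1 t <= - d.
    move=> t0t; have t0t' : t0 <= t by lra.
    have h := @increment_le _ v1 v2 (- d) t0 t t0t' (fun x _ => v1v2 x).
    have {}h : v1 t <= v1 t0 + - d * (t - t0).
      by apply: h => x /andP[/ltW t0x _]; exact/v2led/vb.
    nra.
  (* From time [t0 + 1] on the slope is at most [- d]: by [T] the whole
     height [v (t0 + 1)] has been lost. *)
  pose T := t0 + 1 + v (t0 + 1) / d.
  have T0 : t0 + 1 <= T by rewrite lerDl divr_ge0 ?ltW.
  have h := @increment_le _ v v1 (- d) _ _ T0 (fun x _ => vv1 x).
  have {}h : v T <= v (t0 + 1) + - d * (T - (t0 + 1)).
    by apply: h => x /andP[/ltW ? _]; exact: slope.
  have := vpos T; rewrite ltNge => /negP; apply; apply: (le_trans h).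
  rewrite /T addrAC subrr add0r mulNr mulrC divfK ?gt_eqF//; lra.
have cv : continuous v.
  by move=> t; apply/differentiable_continuous/derivable1_diffP; have [] := vv1 t.
have [c [t0c vc] above] := first_passage_le cv t01 vt1.
have {}t0c : t0 < c.
  by rewrite lt_neqAle t0c andbT; apply/eqP => t0E; move: vc; rewrite -t0E; lra.
have slope_le x : t0 <= x <= c -> v1 c <= v1 x - d * (c - x).
  move=> /andP[t0x xc]; rewrite -mulNr.
  apply: (increment_le xc (fun x _ => v1v2 x)) => y /andP[xy yc].
  by apply/v2led/ltW/above => //; rewrite (le_trans t0x)// ltW.
have [x /andP[t0x xc] vE] := mean_value t0c (fun x _ => vv1 x).
have W1x : v1 c <= v1 x - d * (c - x) by apply: slope_le; rewrite !ltW.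
have W1t : v1 c <= v1 t0 - d * (c - t0) by apply: slope_le; rewrite lexx ltW.
pose W := - v1 c.
have Wt : d * (c - t0) <= W by rewrite /W; lra.
have Wx : v t0 - b <= W * (c - t0).
  rewrite /W; have : v1 c <= v1 x by nra.
  nra.
have W0 : 0 < W by apply: lt_le_trans Wt; rewrite mulr_gt0// subr_gt0.
have WW : 4 * b < W * W.
  have : 4 * b < d * (v t0 - b).
    by move: high; rewrite -ltrBrDl ltr_pdivrMr// [d * _]mulrC.
  move=> h; apply: (lt_le_trans h).
  apply: (@le_trans _ _ (d * (W * (c - t0)))); first by rewrite ler_wpM2l// ltW.
  by rewrite mulrCA ler_wpM2l// ltW.
have cW : c <= c + W / 2 by rewrite lerDl; lra.
have : v (c + W / 2) <= v c + (- (W / 2)) * (c + W / 2 - c).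
  apply: (increment_le cW (fun x _ => vv1 x)) => y /andP[cy yW].
  have : v1 y <= v1 c + 1 * (y - c).
    by apply: (increment_le (ltW cy) (fun x _ => v1v2 x)).
  rewrite /W in yW *; lra.
have := vpos (c + W / 2).
rewrite [c + _ - c]addrAC subrr add0r; nra.
Qed.

(** From each point, one of the two directions is a descent. *)
Lemma concave_above_height_le (R : realType) (v v1 v2 : R -> R) (b d : R) :
  (forall t : R, is_derive t 1 v (v1 t)) -> (forall t : R, is_derive t 1 v1 (v2 t)) ->
  (forall t, 0 < v t) -> 0 < b -> 0 < d ->
  (forall t, v2 t <= 1) -> (forall t, b <= v t -> v2 t <= - d) ->
  forall t, v t <= b + 4 * b / d.
Proof.
move=> vv1 v1v2 vpos b0 d0 v2le1 v2led t.
have [v1t|/ltW v1t] := leP (v1 t) 0; first exact: (no_high_descent vv1 v1v2).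
rewrite -[t]opprK.
apply: (@no_high_descent _ (fun s => v (- s)) (fun s => - v1 (- s))
                           (fun s => v2 (- s)) b d (- t)) => //=.
- exact: is_derive_reflect.
- move=> s; have := is_deriveN (is_derive_reflect v1v2 s).
  by rewrite opprK.
- by move=> s; exact: v2led.
- by rewrite opprK oppr_le0.
Qed.

(** If [v] does not increase at 0, concavity keeps [v >= v 0 / 2] on [[0, 1/2]].
    There [v'' <= - 4 v 0], so that the slope at [1/2] is at most [- 2 v 0], and
    the second half of the interval costs all of the height [v 0].  The
    constant 8 is what this argument requires; an eigenvalue comparison
    would allow any constant above [pi ^ 2 / 4]. *)
Lemma no_strongly_concave_descent (R : realType) (v v1 v2 : R -> R) :
  (forall t : R, is_derive t 1 v (v1 t)) -> (forall t : R, is_derive t 1 v1 (v2 t)) ->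
  (forall t, 0 < v t) -> (forall t, 0 <= t <= 1 -> v2 t <= - 8 * v t) ->
  0 < v1 0.
Proof.
move=> vv1 v1v2 vpos v2le; rewrite ltNge; apply/negP => v10.
have v1_le x y : 0 <= x -> x <= y -> y <= 1 -> v1 y <= v1 x.
  move=> x0 xy y1; have -> : v1 x = v1 x + 0 * (y - x) by lra.
  apply: (increment_le xy (fun x _ => v1v2 x)) => z /andP[xz zy].
  have : v2 z <= - 8 * v z by apply: v2le; apply/andP; split; lra.
  by have := vpos z; lra.
pose h : R := 1 / 2.
have h01 : 0 < h < 1 by rewrite /h; lra.
have [h0 h1] := andP h01.
have [x /andP[x0 xh] vE1] := mean_value h0 (fun x _ => vv1 x).
have [y /andP[hy y1] vE2] := mean_value h1 (fun x _ => vv1 x).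
have xy : v1 y <= v1 x by apply: v1_le; lra.
have v_h : v 0 / 2 <= v h by have := vpos 1; rewrite /h in vE1 vE2 *; nra.
have v_ge t : 0 <= t -> t <= h -> v h <= v t.
  move=> t0 th; have -> : v t = v t + 0 * (h - t) by lra.
  apply: (increment_le th (fun x _ => vv1 x)) => z /andP[tz zh].
  by apply: le_trans v10; apply: v1_le; lra.
have : v1 h <= v1 0 + (- 8 * (v 0 / 2)) * (h - 0).
  apply: (increment_le (ltW h0) (fun x _ => v1v2 x)) => z /andP[z0 zh].
  have : v2 z <= - 8 * v z by apply: v2le; apply/andP; split; lra.
  have : v h <= v z by apply: v_ge; lra.
  lra.
have : v h <= v 0 + 0 * (h - 0).
  apply: (increment_le (ltW h0) (fun x _ => vv1 x)) => z /andP[z0 zh].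
  by apply: le_trans v10; apply: v1_le; lra.
have yh : v1 y <= v1 h by apply: v1_le; lra.
have := vpos 1; have := vpos 0; rewrite /h in v10 v_h vE2 yh *; nra.
Qed.

Lemma no_strongly_concave (R : realType) (v v1 v2 : R -> R) :
  (forall t : R, is_derive t 1 v (v1 t)) -> (forall t : R, is_derive t 1 v1 (v2 t)) ->
  (forall t, 0 < v t) ->
  ~ (forall t, -1 <= t <= 1 -> v2 t <= - 8 * v t).
Proof.
move=> vv1 v1v2 vpos v2le.
have : 0 < v1 0.
  apply: (no_strongly_concave_descent vv1 v1v2 vpos) => t /andP[t0 t1].
  by apply: v2le; apply/andP; split; lra.
suff : 0 < - v1 (- 0) by rewrite oppr0; lra.
apply: (@no_strongly_concave_descent _ (fun s => v (- s)) (fun s => - v1 (- s))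
                                       (fun s => v2 (- s))) => //.
- exact: is_derive_reflect.
- move=> s; have := is_deriveN (is_derive_reflect v1v2 s).
  by rewrite opprK.
- by move=> t /andP[t0 t1]; apply: v2le; apply/andP; split; lra.
Qed.

(** * Antiderivative, powers and sign conditions *)

(** Integrating from [-1] makes the derivative two-sided at 0, where [B] is
    normalised. *)
Lemma continuous_antiderivative (R : realType) (A : R -> R) : continuous A ->
  exists2 B : R -> R, B 0 = 0 & forall x : R, -1 < x -> is_derive x 1 B (A x).
Proof.
move=> cA.
pose F (x : R) : R := (\int[@lebesgue_measure R]_(t in `[(-1 : R), x]) A t)%R.
have dF (x : R) : -1 < x -> is_derive x 1 F (A x).
  move=> x1; have [||dF F'] := @continuous_FTC1_closed R A (-1) x (x + 1) _ _ x1 (cA x).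
  - by rewrite ltrDl.
  - apply: continuous_compact_integrable; first exact: segment_compact.
    exact: continuous_subspaceT.
  - by split; [exact: dF | rewrite -derive1E F'].
exists (fun x => F x - F 0); first by rewrite subrr.
move=> x x1; rewrite -[A x]subr0.
exact: is_deriveB (dF x x1) (is_derive_cst (F 0) (x : R^o) (1 : R^o)).
Qed.

(** The quotient [x ^ (q - 1) / x = x ^ (q - 2)] is nonincreasing as [q < 2],
    hence at least its value at the bound [M]. *)
Lemma sublinear_ge_linear (R : realType) (q M x : R) :
  q < 2 -> 0 < x -> x <= M -> x * (M `^ (2 - q))^-1 <= x `^ (q - 1).
Proof.
move=> q2 x0 xM; have M0 : 0 < M by exact: lt_le_trans xM.
have -> : x `^ (q - 1) = x * (x `^ (2 - q))^-1.
  rewrite -powRN -[X in X * _]powRr1 ?ltW// -powRD; first by congr powR; lra.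
  by rewrite (gt_eqF x0) implybT.
apply: ler_wpM2l; first exact: ltW.
rewrite lef_pV2 ?posrE ?powR_gt0//.
by apply: ge0_ler_powR => //; rewrite ?nnegrE ?ltW// subr_gt0.
Qed.

Lemma sub_powR_le1 (R : realType) (r x : R) : 1 <= r -> 0 < x -> x - x `^ r <= 1.
Proof.
move=> r1 x0; have [x1|/ltW x1] := leP x 1; first by have := powR_ge0 x r; lra.
by have := le1r_powR x1 r1; lra.
Qed.

Lemma two_powR_gt1 (R : realType) (p : R) : 2 < p -> 1 < (2 : R) `^ (p - 2).
Proof.
move=> p2; have p20 : 0 < p - 2 by lra.
have := @gt0_ltr_powR R _ p20 1 2; rewrite powR1 !nnegrE; apply; lra.
Qed.

Lemma sub_powR_le_neg (R : realType) (p x : R) : 2 < p -> 2 <= x ->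
  x - x `^ (p - 1) <= - (2 * (2 `^ (p - 2) - 1)).
Proof.
move=> p2 x2.
have -> : x `^ (p - 1) = x * x `^ (p - 2).
  rewrite -(@mulr_powRB1 _ x (p - 1)); [|lra|lra].
  by congr (_ * _ `^ _); lra.
have : 2 `^ (p - 2) <= x `^ (p - 2).
  by apply: ge0_ler_powR; rewrite ?nnegrE; lra.
have : 1 < (2 : R) `^ (p - 2) by exact: two_powR_gt1.
nra.
Qed.

(** At [s = 0] the product [s * g s] carries no information; the sign of [g 0]
    comes from continuity. *)
Lemma sign_preserving_nonneg (R : realType) (g : R -> R) : continuous g ->
  (forall s, 0 <= s * g s) -> forall s, 0 <= s -> 0 <= g s.
Proof.
move=> cg sg s; rewrite le_eqVlt => /predU1P[<-|s0]; last first.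
  by have := sg s; rewrite pmulr_rge0.
have g0 : g x @[x --> (0 : R)^'+] --> g 0 by exact/cvg_at_right_filter/cg.
apply: (cvgr_to_ge g0).
near=> x; have x0 : 0 < x by near: x; exact: nbhs_right_gt.
by have := sg x; rewrite pmulr_rge0.
Unshelve. all: by end_near. Qed.

(** * Nonexistence of positive solutions *)

Theorem proposition2 (R : realType) (p q theta : R) (a1 A g : R -> R)
  (hq1 : 1 < q) (hq2 : q < 2) (hp : 2 < p)
  (htheta2 : 2 < theta) (htheta3 : theta <= 3)
  (ha1_Lp : a1 \in Lfun (@lebesgue_measure R) (2 / (2 - q))%:E)
  (ha1_cont : continuous a1)
  (ha1_pos : forall t : R, 0 < a1 t)
  (ha1_even : forall t : R, a1 (- t) = a1 t)
  (hA_lip : lipschitz A)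
  (hA_C1 : class_C 1 A)
  (hA_mono : {homo A : s t / s <= t})
  (hA_ge : exists gamma : R, [/\ 0 < gamma, gamma < 1 & forall t : R, gamma <= A t])
  (hg_cont : continuous g)
  (hg_bound : forall s : R, 0 <= s * g s /\ s * g s <= `|s| `^ theta) :
  exists Lambda0 : R, 0 < Lambda0 /\
    forall lambda : R, Lambda0 < lambda ->
      ~ (exists u : R -> R, H1_positive_solution p q a1 A g lambda u).
Proof.
have [gamma [gamma0 _ A_ge]] := hA_ge.
have dA x : derivable A x 1 by exact: (hA_C1.1 0%N).
have cA : continuous A.
  by move=> x; apply/differentiable_continuous/derivable1_diffP.
have [B B0 dB] := continuous_antiderivative cA.
have g_ge0 : forall s, 0 <= s -> 0 <= g s.
  by apply: sign_preserving_nonneg => // s; have [] := hg_bound s.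
have dB_ge0 x y : 0 <= x -> forall z : R, x <= z <= y -> is_derive z 1 B (A z).
  by move=> x0 z /andP[xz _]; apply: dB; lra.
have B_ge x y : 0 <= x -> x <= y -> B x + gamma * (y - x) <= B y.
  by move=> x0 xy; apply: (increment_ge xy (dB_ge0 x y x0)).
have B_le x : 0 <= x -> B x <= A x * x.
  move=> x0; have := increment_le (k := A x) x0 (dB_ge0 0 x (lexx 0)).
  by rewrite B0 add0r subr0; apply => y /andP[_ yx]; apply/hA_mono/ltW.
pose b := B 2.
have b0 : 0 < b.
  have : B 0 + gamma * (2 - 0) <= b by apply: B_ge; lra.
  by rewrite B0; lra.
pose d : R := 2 * (2 `^ (p - 2) - 1).
have d0 : 0 < d.
  have : 1 < (2 : R) `^ (p - 2) by exact: two_powR_gt1.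
  by rewrite /d; lra.
(* [M] bounds every solution, for every [lambda]: it is the height bound on
   [B u] divided by the slope of the lower bound [gamma x <= B x]. *)
pose M := (b + 4 * b / d) / gamma.
have M0 : 0 < M by rewrite divr_gt0// addr_gt0// divr_gt0// mulr_gt0.
have AM0 : 0 < A M by apply: lt_le_trans (A_ge M).
have [t1 _ a1_ge] : exists2 c, c \in `[-1, 1] & forall t, t \in `[-1, 1] -> a1 c <= a1 t.
  by apply: EVT_min; [lra | exact: continuous_subspaceT].
pose m := a1 t1 * (M `^ (2 - q))^-1.
have m0 : 0 < m by rewrite mulr_gt0 ?invr_gt0 ?powR_gt0.
(* With this threshold, [lambda m u >= u + 8 A(M) u >= u + 8 B u]. *)
exists ((8 * A M + 1) / m); split; first by rewrite divr_gt0//; lra.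
move=> lambda; rewrite ltr_pdivrMr// => lambda_gt.
have lambda0 : 0 < lambda by rewrite -(pmulr_lgt0 _ m0); lra.
move=> [u [_ u_C2 u_eq u_pos _]].
have du (t : R) : is_derive t 1 u (derive1 u t).
  by rewrite derive1E; apply/derivableP; exact: (u_C2.1 0%N).
pose w := fun s => A (u s) * derive1 u s.
have dw (t : R) : is_derive t 1 w (derive1 w t).
  rewrite derive1E; apply/derivableP; apply: derivableM.
    by have [] := is_derive1_comp (derivableP (dA (u t))) (du t).
  exact: (u_C2.1 1%N).
have dv (t : R) : is_derive t 1 (B \o u) (w t).
  by apply: is_derive1_comp; apply: dB; have := u_pos t; lra.
have v_pos t : 0 < (B \o u) t.
  have : B 0 + gamma * (u t - 0) <= B (u t) by apply: B_ge => //; exact: ltW.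
  by rewrite B0 /=; have := mulr_gt0 gamma0 (u_pos t); lra.
have w_eq t : derive1 w t =
    u t - lambda * a1 t * u t `^ (q - 1) - u t `^ (p - 1) - g `|derive1 u t|.
  by have := u_eq t; rewrite gtr0_norm// -/w; lra.
have source_ge0 t : 0 <= lambda * a1 t * u t `^ (q - 1).
  by rewrite !mulr_ge0 ?powR_ge0// ltW.
have w_le t : derive1 w t <= u t - u t `^ (p - 1).
  by rewrite w_eq; have := source_ge0 t; have := g_ge0 _ (normr_ge0 (derive1 u t)); lra.
have u_le t : u t <= M.
  have : (B \o u) t <= b + 4 * b / d.
    apply: (concave_above_height_le dv dw v_pos b0 d0) => {}t.
      by apply: le_trans (w_le t) _; apply: sub_powR_le1 => //; lra.
    move=> bv; apply: le_trans (w_le t) _; apply: sub_powR_le_neg => //.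
    rewrite leNgt; apply/negP => u2; move: bv; apply/negP; rewrite -ltNge.
    have := B_ge _ _ (ltW (u_pos t)) (ltW u2); rewrite -/b /=.
    have : 0 < gamma * (2 - u t) by rewrite mulr_gt0// subr_gt0.
    lra.
  move=> v_le; rewrite ler_pdivlMr// mulrC; apply: le_trans v_le.
  by have := B_ge 0 (u t) (lexx 0) (ltW (u_pos t)); rewrite B0 add0r subr0.
apply: (no_strongly_concave dv dw v_pos) => t t11.
have v_le : B (u t) <= A M * u t.
  apply: le_trans (B_le _ (ltW (u_pos t))) _.
  by rewrite ler_wpM2r ?hA_mono// ltW.
have : u t * (lambda * m) <= lambda * a1 t * u t `^ (q - 1).
  rewrite mulrCA -mulrA ler_wpM2l ?(ltW lambda0)// /m mulrCA.
  apply: ler_pM; [exact: ltW | | | exact: sublinear_ge_linear].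
    by rewrite mulr_ge0 ?invr_ge0 ?powR_ge0// ltW.
  by apply: a1_ge; rewrite in_itv.
have : u t * (8 * A M + 1) <= u t * (lambda * m).
  by rewrite ler_wpM2l// ltW.
have := w_eq t; have := g_ge0 _ (normr_ge0 (derive1 u t)).
have := powR_ge0 (u t) (p - 1).
rewrite /=; lra.
Qed.
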